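(* Let $\mathcal{O}_1$ and $\mathcal{O}_2$ be two oracles for the same problem. If there is an emulation of $\mathcal{O}_1$ by $\mathcal{O}_2$, then the oracle complexity of $\mathcal{O}_1$ is at least that of $\mathcal{O}_2$. Here oracle complexity can be worst-case, randomized, distributional, or high-probability oracle complexity, and the same holds for each of these for bounded-error algorithms.
   Context: A problem consists of a family $\mathcal{F}$ of instances, each with a set of correct outputs. An oracle $\mathcal{O}$ assigns to each instance $f\in\mathcal F$ and each query $x$ in its query set $\operatorname{dom}\mathcal{O}$ an answer $\mathcal{O}(x)=\mathcal{O}_f(x)$ in its answer set $\operatorname{cod}\mathcal{O}$. Emulation of $\mathcal{O}_1$ by $\mathcal{O}_2$: a pair of functions, not depending on the instance, consisting of a query emulation $q:\operatorname{dom}\mathcal{O}_1\to\operatorname{dom}\mathcal{O}_2$ and an answer emulation $a:\operatorname{dom}\mathcal{O}_1\times\operatorname{cod}\mathcal{O}_2\to\operatorname{cod}\mathcal{O}_1$ such that for every instance and all $x\in\operatorname{dom}\mathcal{O}_1$, $\mathcal{O}_1(x)=a(x,\mathcal{O}_2(q(x)))$. Complexities. $\mathcal{A}(\mathcal{O})$ is the set of deterministic algorithms that access the instance only by adaptive queries to $\mathcal{O}$; $T_A(f)$ is the number of queries made by $A$ on instance $f$ in order to produce a correct output; $\Delta(\mathcal B)$ is the set of probability distributions on $\mathcal{B}$. Worst-case: $\inf_{A\in\mathcal{A}(\mathcal{O})}\sup_{f\in\mathcal{F}}T_A(f)$. Randomized: $\inf_{A\in\Delta(\mathcal{A}(\mathcal{O}))}\sup_{f\in\mathcal{F}}\mathbb{E}_A[T_A(f)]$.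 Distributional: $\sup_{F\in\Delta(\mathcal{F})}\inf_{A\in\mathcal{A}(\mathcal{O})}\mathbb{E}_F[T_A(F)]$. High-probability: $\sup_{F\in\Delta(\mathcal{F})}\inf_{A\in\mathcal{A}(\mathcal{O})}\sup\{\tau:\mathbb{P}_F[T_A(F)\ge\tau]=1-o(1)\}$. For bounded-error algorithms with error bound $P_e$, the algorithms considered need only give a correct output with probability at least $1-P_e$, and in the high-probability complexity $1-o(1)$ is replaced by $1-P_e-o(1)$. *)

(* Defs.v *)
From mathcomp Require Import all_boot all_order all_algebra.
From mathcomp Require Import all_classical all_reals all_analysis.
From mathcomp Require Import measurable_realfun ess_sup_inf.

Set Implicit Arguments.
Unset Strict Implicit.
Unset Printing Implicit Defensive.

Import Order.TTheory GRing.Theory Num.Theory.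
Import numFieldNormedType.Exports.

Local Open Scope classical_set_scope.
Local Open Scope ring_scope.
Local Open Scope ereal_scope.

Record problem := Problem {
  instance : Type;
  output : Type;
  correct : instance -> set output }.

Record oracle (Pb : problem) := Oracle {
  query : Type;
  answer : Type;
  ask : instance Pb -> query -> answer }.
Arguments ask {Pb} o f x : rename.

Record emulation (Pb : problem) (O1 O2 : oracle Pb) := Emulation {
  query_emulation : query O1 -> query O2;
  answer_emulation : query O1 -> answer O2 -> answer O1;
  emulationE : forall (f : instance Pb) (x : query O1),
    ask O1 f x = answer_emulation x (ask O2 f (query_emulation x)) }.

(* A deterministic adaptive algorithm maps the answers received so far (oldest
   first) to its next query or to its final output. Its earlier queries are
   determined by these answers, so they need not be recorded. *)
Definition algorithm (Pb : problem) (O : oracle Pb) : Type :=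
  seq (answer O) -> query O + output Pb.

(* [run A f h n y]: on instance f, after the answers h, the algorithm A makes
   exactly n further queries and then outputs y. *)
Inductive run (Pb : problem) (O : oracle Pb) (A : algorithm O)
    (f : instance Pb) : seq (answer O) -> nat -> output Pb -> Prop :=
| run_output h y : A h = inr y -> run A f h 0 y
| run_query h x n y : A h = inl x ->
    run A f (rcons h (ask O f x)) n y -> run A f h n.+1 y.

Definition succeeds (Pb : problem) (O : oracle Pb) (A : algorithm O)
    (f : instance Pb) : Prop :=
  exists n y, run A f [::] n y /\ correct f y.

(* T_A(f): the number of queries made in order to produce a correct output; it
   is +oo if A never stops on f or stops with an incorrect output. The set
   below has at most one element, and ereal_inf set0 = +oo. *)
Definition query_count (R : realType) (Pb : problem) (O : oracle Pb)
    (A : algorithm O) (f : instance Pb) : \bar R :=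
  ereal_inf [set n%:R%:E | n in
    [set n | exists2 y, run A f [::] n y & correct f y]].

(* T_A(f) for an algorithm that is allowed to err: the number of queries made
   until A stops, whether or not the output is correct. *)
Definition stopping_count (R : realType) (Pb : problem) (O : oracle Pb)
    (A : algorithm O) (f : instance Pb) : \bar R :=
  ereal_inf [set n%:R%:E | n in [set n | exists y, run A f [::] n y]].

(* Elements of Delta(B), presented as B-valued random elements on a probability
   space. No sigma-algebra on B is imposed: a probability measure on any
   sigma-algebra of B is covered by taking the identity as random element. The
   complexities below range over the random elements for which all the
   quantities whose expectation or probability is taken are measurable. *)
Record distribution (R : realType) (B : Type) := Distribution {
  sample_display : measure_display;
  sample_space : measurableType sample_display;
  law : probability sample_space R;
  draw : sample_space -> B }.
Arguments draw {R B} d w : rename.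

Section complexities.
Context (R : realType) (Pb : problem) (O : oracle Pb).

Definition worst_case : \bar R :=
  ereal_inf [set ereal_sup [set query_count R A f | f in setT]
            | A in [set: algorithm O]].

Definition random_algorithm (D : distribution R (algorithm O)) : Prop :=
  forall f, measurable_fun setT (fun w => query_count R (draw D w) f).

Definition randomized : \bar R :=
  ereal_inf [set v | exists2 D, random_algorithm D &
    v = ereal_sup [set \int[law D]_w query_count R (draw D w) f | f in setT]].

Definition random_instance (D : distribution R (instance Pb)) : Prop :=
  forall A : algorithm O,
    measurable_fun setT (fun w => query_count R A (draw D w)).

Definition distributional : \bar R :=
  ereal_sup [set v | exists2 D, random_instance D &
    v = ereal_inf [set \int[law D]_w query_count R A (draw D w)
                  | A in [set: algorithm O]]].

(* Bounded-error versions, with error bound Pe. *)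

(* For a deterministic algorithm on a fixed instance the probability of a
   correct output is 0 or 1. *)
Definition bounded_worst_case (Pe : R) : \bar R :=
  ereal_inf [set ereal_sup [set stopping_count R A f | f in setT]
            | A in [set A : algorithm O |
                forall f, (1 - Pe <= \1_[set g | succeeds A g] f)%R]].

Definition bounded_random_algorithm (Pe : R)
    (D : distribution R (algorithm O)) : Prop :=
  forall f, [/\ measurable_fun setT (fun w => stopping_count R (draw D w) f),
                measurable [set w | succeeds (draw D w) f] &
                (1 - Pe)%:E <= law D [set w | succeeds (draw D w) f]].

(* The worst case of a randomized algorithm, over both the instances and the
   (almost sure) outcomes of its random choices. *)
Definition bounded_worst_case_randomized (Pe : R) : \bar R :=
  ereal_inf [set v | exists2 D, bounded_random_algorithm Pe D &
    v = ereal_sup [set ess_sup (law D)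
                         (fun w => stopping_count R (draw D w) f)
                  | f in setT]].

Definition bounded_randomized (Pe : R) : \bar R :=
  ereal_inf [set v | exists2 D, bounded_random_algorithm Pe D &
    v = ereal_sup [set \int[law D]_w stopping_count R (draw D w) f
                  | f in setT]].

Definition bounded_random_instance (D : distribution R (instance Pb)) : Prop :=
  forall A : algorithm O,
    measurable_fun setT (fun w => stopping_count R A (draw D w)) /\
    measurable [set w | succeeds A (draw D w)].

Definition bounded_algorithm (Pe : R) (D : distribution R (instance Pb))
    (A : algorithm O) : Prop :=
  (1 - Pe)%:E <= law D [set w | succeeds A (draw D w)].

Definition bounded_distributional (Pe : R) : \bar R :=
  ereal_sup [set v | exists2 D, bounded_random_instance D &
    v = ereal_inf [set \int[law D]_w stopping_count R A (draw D w)
                  | A in bounded_algorithm Pe D]].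

End complexities.

(* The high-probability complexity is asymptotic: problem, oracle, distribution
   and algorithm depend on a parameter i, and o(1) refers to the filter L on the
   parameters. The bound tau may depend on i as well; as functions of i have no
   suprema in general, the bounds compared are those of a family [scale c],
   c : R, and the supremum is taken over c. For scale c i = c this is
   sup {tau | P[T_A(F) >= tau] = 1 - o(1)}; scale c i = c * r i measures tau in
   units of a growth rate r; and a family that is constant in c tells whether
   one given function of i is a lower bound with high probability. *)
Section high_probability.
Context (R : realType) (I : Type) (L : set_system I) (Pb : I -> problem).
Context (scale : R -> I -> R) (O : forall i, oracle (Pb i)).

Definition high_probability : \bar R :=
  ereal_sup [set v |
    exists2 D : forall i, distribution R (instance (Pb i)),
      forall i, random_instance (O i) (D i) &
    v = ereal_inf
      [set ereal_sup [set c%:E | c in [set c |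
          exists2 e : I -> R, e @ L --> (0 : R)%R &
            forall i, law (D i) [set w |
                (scale c i)%:E <= query_count R (A i) (draw (D i) w)]
              = (1 - e i)%:E]]
      | A in [set: forall i, algorithm (O i)]]].

(* The probability is required to be at least 1 - Pe - o(1): for Pe = 0 this is
   the same as being 1 - o(1), whereas for Pe > 0 the probability may well
   exceed 1 - Pe, e.g. for an algorithm that never errs. *)
Definition bounded_high_probability (Pe : R) : \bar R :=
  ereal_sup [set v |
    exists2 D : forall i, distribution R (instance (Pb i)),
      forall i, bounded_random_instance (O i) (D i) &
    v = ereal_inf
      [set ereal_sup [set c%:E | c in [set c |
          exists2 e : I -> R, e @ L --> (0 : R)%R &
            forall i, (1 - Pe - e i)%:E <= law (D i) [set w |
                (scale c i)%:E <= stopping_count R (A i) (draw (D i) w)]]]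
      | A in [set A : forall i, algorithm (O i) |
          forall i, bounded_algorithm Pe (D i) (A i)]]].

End high_probability.

(* Main.v *)
Require Import Defs.
From mathcomp Require Import all_boot all_order all_algebra.
From mathcomp Require Import all_classical all_reals all_analysis.
Import Order.TTheory GRing.Theory Num.Theory.
Import numFieldNormedType.Exports.
Local Open Scope classical_set_scope.
Local Open Scope ring_scope.
Local Open Scope ereal_scope.

(** An algorithm [A] for [O1] becomes one for [O2] by emulating each query and
    each answer. On every instance the new algorithm stops after the same number
    of queries with the same output as [A]. All counts and success events are
    therefore unchanged, so every infimum over algorithms for [O2] also covers
    the emulated algorithms for [O1]. Moreover, an instance distribution that is
    admissible for [O2] is admissible for [O1], measurability being required for
    all algorithms. *)

Section emulated_algorithm.
Context {Pb : problem} {O1 O2 : oracle Pb} (E : emulation O1 O2).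
Implicit Types (A : algorithm O1) (f : instance Pb).

(* The queries of [O1] that the answers in [h] respond to are recovered by
   replaying [A]; answers received after [A] has stopped are dropped. *)
Definition emulated_history A (h : seq (answer O2)) : seq (answer O1) :=
  foldl (fun h1 a => if A h1 is inl x then rcons h1 (answer_emulation E x a)
                     else h1) [::] h.

Definition emulated A : algorithm O2 := fun h =>
  match A (emulated_history A h) with
  | inl x => inl (query_emulation E x)
  | inr y => inr y
  end.

Lemma emulated_history_rcons A h x a : A (emulated_history A h) = inl x ->
  emulated_history A (rcons h a) =
  rcons (emulated_history A h) (answer_emulation E x a).
Proof. by rewrite /emulated_history foldl_rcons => ->. Qed.

(** By induction on the number of remaining queries, for all [h] at once. One query extends [h] by
    an answer of [O2] whose translation is [ask O1 f x] by [emulationE], so the replayed history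
    grows exactly as that of [A] does. *)
Lemma run_emulated A f h n y :
  run (emulated A) f h n y <-> run A f (emulated_history A h) n y.
Proof.
elim: n h => [|n IHn] h.
  split=> r; inversion r as [h' y' Ah|]; subst; apply: run_output.
    by move: Ah; rewrite /emulated; case: (A _) => // z [->].
  by rewrite /emulated Ah.
split=> r; inversion r as [|h' x m y' Ah r']; subst.
- move: Ah; rewrite /emulated; case Ah: (A _) => [z|//] [xE].
  (* Since [query_emulation] may fail to be injective, [z] is read off from [A]; only its image is
     known to be [x]. *)
  apply: (@run_query _ _ _ _ _ z) => //.
  rewrite (emulationE E) -(emulated_history_rcons _ _ _ _ Ah).
  by rewrite xE; apply/IHn.
- apply: (@run_query _ _ _ _ _ (query_emulation E x)).
    by rewrite /emulated Ah.
  by apply/IHn; rewrite (emulated_history_rcons _ _ _ _ Ah) -emulationE.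
Qed.

(** An equality of predicates can be rewritten inside the counts and [succeeds]; the empty history
    replays to itself. *)
Lemma run_emulatedE A f : run (emulated A) f [::] = run A f [::].
Proof. by apply/funext => n; apply/funext => y; apply/propext/run_emulated. Qed.

Lemma succeeds_emulated A f : succeeds (emulated A) f = succeeds A f.
Proof. by rewrite /succeeds run_emulatedE. Qed.

Lemma query_count_emulated (R : realType) A f :
  query_count R (emulated A) f = query_count R A f.
Proof. by rewrite /query_count run_emulatedE. Qed.

Lemma stopping_count_emulated (R : realType) A f :
  stopping_count R (emulated A) f = stopping_count R A f.
Proof. by rewrite /stopping_count run_emulatedE. Qed.

Definition emulatedE :=
  (succeeds_emulated, query_count_emulated, stopping_count_emulated).

End emulated_algorithm.

Section distributions.
Context {R : realType} {Pb : problem} {O1 O2 : oracle Pb}.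
Context (E : emulation O1 O2).

(** The pushforward along [emulated E]: for random elements this is composition with [draw], on the
    same sample space. *)
Definition emulated_distribution (D : Defs.distribution R (algorithm O1)) :
    Defs.distribution R (algorithm O2) :=
  Distribution (law D) (fun w => emulated E (draw D w)).

Lemma random_algorithm_emulated D :
  random_algorithm D -> random_algorithm (emulated_distribution D).
Proof.
by move=> mD f /=; under eq_fun do rewrite emulatedE; exact: mD.
Qed.

Lemma bounded_random_algorithm_emulated Pe D :
  bounded_random_algorithm Pe D ->
  bounded_random_algorithm Pe (emulated_distribution D).
Proof.
move=> mD f /=; under eq_fun do rewrite emulatedE.
by under eq_set do rewrite emulatedE; exact: mD.
Qed.

Lemma random_instance_emulation (D : Defs.distribution R (instance Pb)) :
  random_instance O2 D -> random_instance O1 D.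
Proof.
move=> mD A; have := mD (emulated E A).
by under eq_fun do rewrite emulatedE.
Qed.

Lemma bounded_random_instance_emulation
    (D : Defs.distribution R (instance Pb)) :
  bounded_random_instance O2 D -> bounded_random_instance O1 D.
Proof.
move=> mD A; have := mD (emulated E A).
by under eq_fun do rewrite emulatedE; under eq_set do rewrite emulatedE.
Qed.

Lemma bounded_algorithm_emulated Pe (D : Defs.distribution R (instance Pb)) A :
  bounded_algorithm Pe D A -> bounded_algorithm Pe D (emulated E A).
Proof.
rewrite /bounded_algorithm.
by under [in X in _ -> X]eq_set do rewrite emulatedE.
Qed.

End distributions.

Section complexities.
Context (R : realType) {Pb : problem} {O1 O2 : oracle Pb}.
Context (E : emulation O1 O2).

Lemma worst_case_emulation : worst_case R O2 <= worst_case R O1.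
Proof.
apply: ereal_inf_le_tmp => _ [A _ <-]; exists (emulated E A) => //.
by under eq_imagel do rewrite emulatedE.
Qed.

Lemma randomized_emulation : randomized R O2 <= randomized R O1.
Proof.
apply: ereal_inf_le_tmp => _ [D mD ->]; exists (emulated_distribution E D).
  exact: random_algorithm_emulated.
congr ereal_sup; apply: eq_imagel => f _ /=.
by under [RHS]eq_integral do rewrite emulatedE.
Qed.

Lemma distributional_emulation : distributional R O2 <= distributional R O1.
Proof.
(* The same [D] serves for [O1]; the value left open by [eexists] becomes the infimum of
   expectations over algorithms for [O1]. *)
apply: ge_ereal_sup => _ [D mD ->]; apply: le_ereal_sup_tmp; eexists.
  by exists D; first exact: random_instance_emulation mD.
apply: ereal_inf_le_tmp => _ [A _ <-]; exists (emulated E A) => //.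
by under eq_integral do rewrite emulatedE.
Qed.

Lemma bounded_worst_case_emulation Pe :
  bounded_worst_case O2 Pe <= bounded_worst_case (R := R) O1 Pe.
Proof.
apply: ereal_inf_le_tmp => _ [A PA <-]; exists (emulated E A) => /=.
  by move=> f; under eq_set do rewrite emulatedE; exact: PA.
by under eq_imagel do rewrite emulatedE.
Qed.

Lemma bounded_worst_case_randomized_emulation Pe :
  bounded_worst_case_randomized O2 Pe
    <= bounded_worst_case_randomized (R := R) O1 Pe.
Proof.
apply: ereal_inf_le_tmp => _ [D mD ->]; exists (emulated_distribution E D).
  exact: bounded_random_algorithm_emulated.
(* The law is shared and the functions agree at every sample point, so the essential suprema are
   equal. *)
congr ereal_sup; apply: eq_imagel => f _ /=.
by under [in RHS]eq_fun do rewrite emulatedE.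
Qed.

Lemma bounded_randomized_emulation Pe :
  bounded_randomized O2 Pe <= bounded_randomized (R := R) O1 Pe.
Proof.
apply: ereal_inf_le_tmp => _ [D mD ->]; exists (emulated_distribution E D).
  exact: bounded_random_algorithm_emulated.
congr ereal_sup; apply: eq_imagel => f _ /=.
by under [RHS]eq_integral do rewrite emulatedE.
Qed.

Lemma bounded_distributional_emulation Pe :
  bounded_distributional O2 Pe <= bounded_distributional (R := R) O1 Pe.
Proof.
apply: ge_ereal_sup => _ [D mD ->]; apply: le_ereal_sup_tmp; eexists.
  by exists D; first exact: bounded_random_instance_emulation mD.
apply: ereal_inf_le_tmp => _ [A PA <-]; exists (emulated E A).
  exact: bounded_algorithm_emulated.
by under eq_integral do rewrite emulatedE.
Qed.

End complexities.

Section high_probability.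
Context {R : realType} {I : Type} (L : set_system I) {Pb : I -> problem}.
Context {O1 O2 : forall i, oracle (Pb i)}.
Context (E : forall i, emulation (O1 i) (O2 i)) (scale : R -> I -> R).

Lemma high_probability_emulation :
  high_probability L scale O2 <= high_probability L scale O1.
Proof.
apply: ge_ereal_sup => _ [D mD ->]; apply: le_ereal_sup_tmp; eexists.
  by exists D; first by move=> i; exact: random_instance_emulation (mD i).
apply: ereal_inf_le_tmp => _ [A _ <-].
exists (fun i => emulated (E i) (A i)) => //.
(* The same [c] are admissible, with the same error term [e], because the events measured by
   [law (D i)] coincide for every [i]. *)
congr ereal_sup; congr image; apply: eq_set => c.
congr ex2; apply/funext => e; apply: eq_forall => i.
by under eq_set do rewrite emulatedE.
Qed.

Lemma bounded_high_probability_emulation Pe :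
  bounded_high_probability L scale O2 Pe
    <= bounded_high_probability L scale O1 Pe.
Proof.
apply: ge_ereal_sup => _ [D mD ->]; apply: le_ereal_sup_tmp; eexists.
  exists D; last by [].
  by move=> i; exact: bounded_random_instance_emulation (mD i).
apply: ereal_inf_le_tmp => _ [A PA <-]; exists (fun i => emulated (E i) (A i)).
  (* The error bound is imposed at each [i] separately, so the emulated family stays admissible. *)
  by move=> i; exact: bounded_algorithm_emulated.
congr ereal_sup; congr image; apply: eq_set => c.
congr ex2; apply/funext => e; apply: eq_forall => i.
by under eq_set do rewrite emulatedE.
Qed.

End high_probability.

(** Families over [I] serve the asymptotic complexities; the others are compared at each [i], and a
    single pair of oracles is a constant family. *)
Theorem mainTheorem3 (R : realType) (I : Type) (L : set_system I)
    (FL : ProperFilter L) (Pb : I -> problem)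
    (O1 O2 : forall i, oracle (Pb i))
    (E : forall i, emulation (O1 i) (O2 i))
    (Pe : R) (Pe01 : (0 <= Pe <= 1)%R) :
  [/\ forall i, worst_case R (O2 i) <= worst_case R (O1 i),
      forall i, randomized R (O2 i) <= randomized R (O1 i),
      forall i, distributional R (O2 i) <= distributional R (O1 i) &
      forall scale : R -> I -> R,
        high_probability L scale O2 <= high_probability L scale O1] /\
  [/\ forall i, bounded_worst_case (O2 i) Pe <= bounded_worst_case (O1 i) Pe /\
        bounded_worst_case_randomized (O2 i) Pe
          <= bounded_worst_case_randomized (O1 i) Pe,
      forall i, bounded_randomized (O2 i) Pe <= bounded_randomized (O1 i) Pe,
      forall i,
        bounded_distributional (O2 i) Pe <= bounded_distributional (O1 i) Pe &
      forall scale : R -> I -> R,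
        bounded_high_probability L scale O2 Pe
          <= bounded_high_probability L scale O1 Pe].
Proof.
split; split=> [i|i|i|scale].
- exact: worst_case_emulation.
- exact: randomized_emulation.
- exact: distributional_emulation.
- exact: high_probability_emulation.
- split; first exact: bounded_worst_case_emulation.
  exact: bounded_worst_case_randomized_emulation.
- exact: bounded_randomized_emulation.
- exact: bounded_distributional_emulation.
- exact: bounded_high_probability_emulation.
Qed.
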